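(* Let $n\geq 2$, let $T_n$ be the twin group with generators $s_1,\ldots,s_{n-1}$, and let $t$ be specialized to a complex number, $t\neq 0$. Let $\eta_1':T_n\to\mathrm{GL}_{n-1}(\mathbb{C})$ be the representation of $T_n$, a composition factor of degree $n-1$ of the representation $\eta_1$ described in the context, given by acting on the generators as follows: $$\eta_1'(s_i)=\left(\begin{array}{c|c|c} I_{i-1} & 0 & 0\\ \hline 0 & \begin{matrix}1-t & t\\ 2-t & t-1\end{matrix} & 0\\ \hline 0&0&I_{n-i-2}\end{array}\right)\quad\text{for } 1\leq i\leq n-2,$$ $$\eta_1'(s_{n-1})=\left(\begin{array}{c|c} I_{n-2} & 0\\ \hline \begin{matrix} t-2 & t-2 & \cdots & t-2\end{matrix} & -1\end{array}\right).$$ Then the representation $\eta_1'$ is irreducible if and only if $t\neq\dfrac{2n-2}{n-2}$ and $t\neq 2$.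
   Context: The twin group $T_n$ has generators $s_1,\ldots,s_{n-1}$ and relations $s_i^2=1$ ($1\le i\le n-1$) and $s_is_j=s_js_i$ ($|i-j|\geq 2$). The representation $\eta_1$ of $T_n$ of degree $n$ is given by the block diagonal matrices $\eta_1(s_i)=\mathrm{diag}\left(I_{i-1},\begin{pmatrix}1-t&t\\2-t&t-1\end{pmatrix},I_{n-i-1}\right)$ for $1\leq i\leq n-1$. It fixes the vector $(1,1,\ldots,1)^T$, and $\eta_1'$ is obtained by writing $\eta_1$ in the basis $v_1=e_1,\ldots,v_{n-1}=e_{n-1},\ v_n=e_1+\cdots+e_n$ of $\mathbb{C}^n$ ($e_1,\ldots,e_n$ the canonical basis) and eliminating the last row and last column of each matrix. $I_r$ denotes the $r\times r$ identity matrix. A representation on $\mathbb{C}^{n-1}$ is irreducible if it has no invariant subspace other than $0$ and $\mathbb{C}^{n-1}$.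
   Formalization: The case n=2, t=2 is excluded (there the claim fails; at n=2 the quotient is undefined and imposes no condition). The displayed matrices are used as such: they are not the composition factor of η_1 and for n≥4 mostly violate the relations of T_n, so the criterion is also stated for them alone. *)

(* Defs.v *)
From HB Require Import structures.
From mathcomp Require Import all_boot all_order all_algebra.
From mathcomp Require Import boolp reals.
From mathcomp Require Import complex.

Set Implicit Arguments.
Unset Strict Implicit.
Unset Printing Implicit Defensive.

Import GRing.Theory.

Local Open Scope quotient_scope.

(* The generators s_1, ..., s_{n-1} are indexed from 0: i : 'I_n.-1 stands for
   s_{i+1}.  As every generator is its own inverse, the group presented by the
   relations below is the quotient of the free monoid on the generators by the
   congruence that the relations generate. *)
Definition twin_word (n : nat) : Type := seq 'I_n.-1.

HB.instance Definition _ n := Choice.on (twin_word n).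

Inductive twin_cong (n : nat) : twin_word n -> twin_word n -> Prop :=
| TwinSquare i : twin_cong [:: i; i] [::]
| TwinFar (i j : 'I_n.-1) : (i.+2 <= j) || (j.+2 <= i) ->
    twin_cong [:: i; j] [:: j; i]
| TwinRefl u : twin_cong u u
| TwinSym u v : twin_cong u v -> twin_cong v u
| TwinTrans u v w : twin_cong u v -> twin_cong v w -> twin_cong u w
| TwinCat u u' v v' : twin_cong u u' -> twin_cong v v' ->
    twin_cong (u ++ v) (u' ++ v').

Section TwinGroup.
Variable n : nat.
Implicit Types u v : twin_word n.

Definition twin_congb : rel (twin_word n) := fun u v => `[< twin_cong u v >].

Lemma twin_congb_refl : reflexive twin_congb.
Proof. by move=> u; apply/asboolP; exact: TwinRefl. Qed.

Lemma twin_congb_sym : symmetric twin_congb.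
Proof. by move=> u v; apply/asboolP/asboolP; exact: TwinSym. Qed.

Lemma twin_congb_trans : transitive twin_congb.
Proof.
move=> v u w /asboolP uv /asboolP vw; apply/asboolP; exact: TwinTrans uv vw.
Qed.

Canonical twin_congb_equiv :=
  EquivRel twin_congb twin_congb_refl twin_congb_sym twin_congb_trans.

Definition twin_group : Type := {eq_quot twin_congb_equiv}.

HB.instance Definition _ := Choice.on twin_group.
HB.instance Definition _ := EqQuotient.on twin_group.

Definition twin_pi : twin_word n -> twin_group := \pi_twin_group.

Lemma twin_piP u v : twin_pi u = twin_pi v <-> twin_cong u v.
Proof. by split=> [/eqmodP/asboolP|?]; last by apply/eqmodP/asboolP. Qed.

Lemma twin_pi_surj (x : twin_group) : exists u, twin_pi u = x.
Proof. by exists (repr x); rewrite /twin_pi reprK. Qed.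

Lemma twin_cong_rev u v : twin_cong u v -> twin_cong (rev u) (rev v).
Proof.
elim=> {u v} [i|i j far|u|u v _|u v w _ uv _ vw|u u' v v' _ uu' _ vv'].
- exact: TwinSquare.
- by apply: TwinFar; rewrite orbC.
- exact: TwinRefl.
- exact: TwinSym.
- exact: TwinTrans uv vw.
- by rewrite !rev_cat; exact: TwinCat.
Qed.

Lemma twin_cong_revl u : twin_cong (rev u ++ u) [::].
Proof.
elim: u => [|i u IHu]; first exact: TwinRefl.
rewrite rev_cons cat_rcons.
apply: TwinTrans IHu; apply: TwinCat (TwinRefl _) _.
by apply: (@TwinCat n [:: i; i] [::] u u (TwinSquare i)); exact: TwinRefl.
Qed.

Definition twin_one : twin_group := twin_pi [::].
Definition twin_mul (x y : twin_group) : twin_group :=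
  twin_pi (repr x ++ repr y).
Definition twin_inv (x : twin_group) : twin_group := twin_pi (rev (repr x)).

Lemma twin_cong_repr u : twin_cong (repr (twin_pi u)) u.
Proof. by apply/twin_piP; rewrite /twin_pi reprK. Qed.

Lemma twin_mul_pi u v : twin_mul (twin_pi u) (twin_pi v) = twin_pi (u ++ v).
Proof. by apply/twin_piP; apply: TwinCat; exact: twin_cong_repr. Qed.

Lemma twin_inv_pi u : twin_inv (twin_pi u) = twin_pi (rev u).
Proof. by apply/twin_piP; apply: twin_cong_rev; exact: twin_cong_repr. Qed.

Lemma twin_mulA : associative twin_mul.
Proof.
move=> x y z; have [u <-] := twin_pi_surj x; have [v <-] := twin_pi_surj y.
by have [w <-] := twin_pi_surj z; rewrite !twin_mul_pi catA.
Qed.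

Lemma twin_mul1g : left_id twin_one twin_mul.
Proof. by move=> x; have [u <-] := twin_pi_surj x; rewrite twin_mul_pi. Qed.

Lemma twin_mulg1 : right_id twin_one twin_mul.
Proof.
by move=> x; have [u <-] := twin_pi_surj x; rewrite twin_mul_pi cats0.
Qed.

Lemma twin_mulVg : left_inverse twin_one twin_inv twin_mul.
Proof.
move=> x; have [u <-] := twin_pi_surj x; rewrite twin_inv_pi twin_mul_pi.
by apply/twin_piP; exact: twin_cong_revl.
Qed.

Lemma twin_mulgV : right_inverse twin_one twin_inv twin_mul.
Proof.
move=> x; have [u <-] := twin_pi_surj x; rewrite twin_inv_pi twin_mul_pi.
by apply/twin_piP; have := twin_cong_revl (rev u); rewrite revK.
Qed.

HB.instance Definition _ := isGroup.Build twin_group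
  twin_mulA twin_mul1g twin_mulg1 twin_mulVg twin_mulgV.

Definition twin_gen (i : 'I_n.-1) : twin_group := twin_pi [:: i].

End TwinGroup.

Local Open Scope ring_scope.

(* The values of such a map are automatically invertible, so this is a
   homomorphism from G to GL_d(F). *)
Definition is_representation (G : groupType) (F : fieldType) (d : nat)
    (rho : G -> 'M[F]_d) : Prop :=
  rho (1%g) = 1%:M /\ forall x y : G, rho (x * y)%g = rho x *m rho y.

(* Matrices act on column vectors.  X is an arbitrary index type, so that the
   notion applies to a representation of a group as well as to the matrices
   assigned to a set of generators. *)
Definition irreducible (X : Type) (F : fieldType) (d : nat)
    (rho : X -> 'M[F]_d) : Prop :=
  forall U : {vspace 'cV[F]_d},
    (forall (x : X) (v : 'cV[F]_d), v \in U -> rho x *m v \in U) ->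
    U = 0%VS \/ U = fullv.

(* The block [[1-t, t], [2-t, t-1]] placed in rows and columns i, i+1 of the
   identity matrix (counted from 0). *)
Definition eta1'_block (F : fieldType) (d : nat) (t : F) (i : nat) : 'M[F]_d :=
  \matrix_(k < d, l < d)
    if (k == i :> nat) && (l == i :> nat) then 1 - t
    else if (k == i :> nat) && (l == i.+1 :> nat) then t
    else if (k == i.+1 :> nat) && (l == i :> nat) then 2 - t
    else if (k == i.+1 :> nat) && (l == i.+1 :> nat) then t - 1
    else (k == l)%:R.

(* The identity matrix with its last row replaced by (t-2, ..., t-2, -1). *)
Definition eta1'_last (F : fieldType) (d : nat) (t : F) : 'M[F]_d :=
  \matrix_(k < d, l < d)
    if k.+1 == d then (if l.+1 == d then -1 else t - 2)
    else (k == l)%:R.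

(* For n >= 4 these matrices satisfy the relations of T_n only for special values
   of t: the images of s_1 and s_{n-1} need not commute. *)
Definition eta1'_gen (F : fieldType) (n : nat) (t : F) (i : 'I_n.-1) :
    'M[F]_n.-1 :=
  if i.+1 == n.-1 then eta1'_last n.-1 t else eta1'_block n.-1 t i.

(* Main.v *)
Require Import Defs.
From mathcomp Require Import all_boot all_order all_algebra.
From mathcomp Require Import boolp reals.
From mathcomp Require Import complex.
From mathcomp Require Import ring.

Set Implicit Arguments.
Unset Strict Implicit.

Import GRing.Theory.
Local Open Scope ring_scope.

(** Why the theorem holds.  A subspace is invariant under a group as soon as it
is invariant under generators of it, so both equivalences are statements about
the n - 1 matrices assigned to the generators.  For n = 2 the space is a line and
there is nothing to exclude.

For n >= 3 put d = n - 1 >= 2.  Each of the matrices is the identity plus a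
matrix of rank one: the block in position i sends v to v + (v_i - v_{i+1}) w_i,
where w_i = (2 - t) e_{i+1} - t e_i, and the last matrix sends v to
v + phi(v) e_{d-1}, where phi(v) = (t - 2) (v_0 + ... + v_{d-2}) - 2 v_{d-1}.
Hence an invariant subspace U contains w_i as soon as one of its vectors has
v_i != v_{i+1}, and e_{d-1} as soon as phi does not vanish on U.

Two obstructions appear.  The vector of ones is fixed by every block, and by the
last matrix exactly if phi vanishes at it, that is if (t - 2) (d - 1) = 2.  If
t = 2, then w_0 and e_0 are proportional, and e_0 spans an invariant line.
Outside these two cases every invariant U != 0 contains e_{d-1}
([invariant_last_basis]): take v != 0 in U.  If v is constant, use phi(v) != 0.
Otherwise some w_i lies in U; the coordinates of w_i at i + 1 and i + 2 are
2 - t != 0 and 0, so w_{i+1} lies in U, and so on up to w_{d-2}, and phi(w_{d-2}) = - (t - 2)^2.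
From e_{d-1} one recovers all basis vectors by descent, because
w_i = (2 - t) e_{i+1} - t e_i and t != 0 ([invariant_full]). *)

(** * Invariance under a group and under its generators *)

Lemma representation_word (n d : nat) (F : fieldType)
    (rho : twin_group n -> 'M[F]_d) (g : 'I_n.-1 -> 'M[F]_d) :
  is_representation rho -> (forall i, rho (twin_gen i) = g i) ->
  forall u : twin_word n,
    rho (twin_pi u) = foldr (fun i A => g i *m A) 1%:M u.
Proof.
move=> [rho1 rhoM] rhog; elim=> [|i u IHu] /=; first exact: rho1.
by rewrite -IHu -rhog -rhoM; congr rho; rewrite -(twin_mul_pi [:: i]).
Qed.

Lemma irreducible_generators (n d : nat) (F : fieldType)
    (rho : twin_group n -> 'M[F]_d) (g : 'I_n.-1 -> 'M[F]_d) :
  is_representation rho -> (forall i, rho (twin_gen i) = g i) ->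
  irreducible rho <-> irreducible g.
Proof.
move=> rho_rep rhog; split=> irr U invU; apply: irr.
  move=> x; have [u <-] := twin_pi_surj x => v Uv.
  rewrite (representation_word rho_rep rhog).
  elim: u => [|i u IHu] /=; first by rewrite mul1mx.
  by rewrite -mulmxA; apply: invU.
by move=> i v Uv; rewrite -rhog; apply: invU.
Qed.

(** * Irreducibility criteria *)

Lemma irreducible_dim1 (X : Type) (F : fieldType) (rho : X -> 'M[F]_1) :
  irreducible rho.
Proof.
move=> U _; have [->|U0] := eqVneq U 0%VS; [by left | right].
apply/eqP; rewrite eqEdim subvf /= dimvf dim_matrix.
by rewrite lt0n dimv_eq0.
Qed.

(** The line of a common eigenvector is invariant, and proper since the dimension
is at least 2. *)
Lemma common_eigenvector_reducible (X : Type) (F : fieldType) (m : nat)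
    (rho : X -> 'M[F]_m.+2) (v : 'cV[F]_m.+2) :
  v != 0 -> (forall x, exists a, rho x *m v = a *: v) -> ~ irreducible rho.
Proof.
move=> v0 eigv irr; have [x w /vlineP[c ->]|v_eq|v_eq] := irr <[v]>%VS.
- have [a va] := eigv x.
  by rewrite -scalemxAr va memvZ // memvZ // memv_line.
- by move: v0; rewrite -memv0 -v_eq memv_line.
- by have := dim_vline v; rewrite v_eq v0 dimvf dim_matrix.
Qed.

Lemma delta_full (F : fieldType) (d : nat) (U : {vspace 'cV[F]_d}) :
  (forall j, delta_mx j 0 \in U) -> U = fullv.
Proof.
move=> Ue; apply/eqP; rewrite eqEsubv subvf; apply/subvP => v _.
rewrite [v]matrix_sum_delta; apply: memv_suml => i _.
by rewrite big_ord1 memvZ.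
Qed.

(** * Steps along consecutive indices *)

(** The pairs (i, i + 1) of consecutive coordinates of a space of dimension m + 1
are indexed by i : 'I_m; [lo] and [hi] are the two members of the pair. *)
Definition lo {m : nat} (i : 'I_m) : 'I_m.+1 := widen_ord (leqnSn m) i.
Definition hi {m : nat} (i : 'I_m) : 'I_m.+1 := lift ord0 i.

Lemma ord_ascend (m : nat) (P : 'I_m.+1 -> Prop) (i : 'I_m.+1) :
  P i -> (forall j : 'I_m, P (lo j) -> P (hi j)) -> P ord_max.
Proof.
move=> Pi up; have [k] := ubnP (m - i); elim: k i Pi => // k IHk i Pi lek.
case: (unliftP ord_max i) => [j|] ei; last by rewrite -ei.
have eij : i = lo j by apply/val_inj; rewrite ei; exact: lift_max.
apply: (IHk (hi j)); first by apply: up; rewrite -eij.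
rewrite eij ltnS in lek; apply: leq_trans lek.
by rewrite /= /bump /= add1n ltn_sub2l.
Qed.

Lemma ord_descend (m : nat) (P : 'I_m.+1 -> Prop) :
  P ord_max -> (forall j : 'I_m, P (hi j) -> P (lo j)) -> forall i, P i.
Proof.
move=> Pmax down i; apply: contrapT => nPi.
by apply: (@ord_ascend m (fun j => ~ P j) i) => // j nPj /down.
Qed.

Section Generators.
Variables (F : fieldType) (m : nat) (t : F).
Implicit Types (v : 'cV[F]_m.+2) (i : 'I_m.+1) (U : {vspace 'cV[F]_m.+2}).

(** The vector w_i that spans the image of the i-th block matrix minus the
identity. *)
Definition root_vec i : 'cV[F]_m.+2 :=
  (2 - t) *: delta_mx (hi i) 0 - t *: delta_mx (lo i) 0.

(** The linear form phi for which the last matrix is v |-> v + phi(v) e_{d-1}. *)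
Definition last_form v : F :=
  (t - 2) * (\sum_i v (lo i) 0) - 2 * v ord_max 0.

(** * The generators as rank-one perturbations of the identity *)

Lemma gen_lo_mxE i :
  eta1'_gen (n := m.+3) t (lo i) =
    1%:M + root_vec i *m (delta_mx 0 (lo i) - delta_mx 0 (hi i)).
Proof.
rewrite /eta1'_gen /= eqSS (ltn_eqF (ltn_ord i)); apply/matrixP => k l.
rewrite !mxE big_ord1 !mxE -!val_eqE /= /bump /= add1n !andbT.
have [->|ki] := eqVneq (k : nat) i; last have [->|ki'] := eqVneq (k : nat) i.+1.
all: have [li|_] := eqVneq (l : nat) i;
  last have [li'|_] := eqVneq (l : nat) i.+1.
all: rewrite ?li ?li' ?(negbTE ki) ?(negbTE ki') ?eqxx
  ?(ltn_eqF (ltnSn i)) ?(gtn_eqF (ltnSn i)) /=; ring.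
Qed.

Lemma gen_loE i v :
  eta1'_gen (n := m.+3) t (lo i) *m v =
    v + (v (lo i) 0 - v (hi i) 0) *: root_vec i.
Proof.
rewrite gen_lo_mxE mulmxDl mul1mx -mulmxA (mulmxBl (delta_mx 0 _)) -!rowE.
by rewrite [row _ _ - _]mx11_scalar mul_mx_scalar !mxE.
Qed.

Lemma gen_max_mxE :
  eta1'_gen (n := m.+3) t ord_max =
    1%:M + delta_mx ord_max 0 *m
      \row_l (if l == ord_max then - 2 else t - 2).
Proof.
rewrite /eta1'_gen eqxx; apply/matrixP => k l.
rewrite !mxE big_ord1 !mxE !eqSS andbT -!val_eqE /=.
case: (eqVneq (k : nat) m.+1) => [->|_] /=; last by ring.
by rewrite [m.+1 == l]eq_sym; case: ifP => _ /=; ring.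
Qed.

Lemma gen_maxE v :
  eta1'_gen (n := m.+3) t ord_max *m v = v + last_form v *: delta_mx ord_max 0.
Proof.
rewrite gen_max_mxE mulmxDl mul1mx -mulmxA [_ *m v]mx11_scalar mul_mx_scalar.
congr (v + _ *: _); rewrite mxE big_ord_recr /= !mxE eqxx mulNr.
congr (_ - _); rewrite mulr_sumr; apply: eq_bigr => j _.
by rewrite !mxE -val_eqE /= ltn_eqF.
Qed.

(** * The two degenerate cases *)

Lemma last_form_const c :
  last_form (const_mx c) = c * ((t - 2) * m.+1%:R - 2).
Proof.
rewrite /last_form mxE; under eq_bigr => j _ do rewrite mxE.
by rewrite sumr_const card_ord -mulr_natr; ring.
Qed.

(** The last generator has another shape than the others, so statements on all
generators are proved separately for the two kinds. *)
Lemma gen_index_split (P : 'I_m.+2 -> Prop) :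
  P ord_max -> (forall i, P (lo i)) -> forall j, P j.
Proof.
move=> Pmax Plo j; case: (unliftP ord_max j) => [i|] -> //.
by have -> : lift ord_max i = lo i by apply/val_inj; exact: lift_max.
Qed.

(** The blocks fix the vector of ones because its consecutive coordinates agree;
the hypothesis makes phi vanish at it. *)
Lemma ones_reducible :
  (t - 2) * m.+1%:R = 2 -> ~ irreducible (eta1'_gen (n := m.+3) t).
Proof.
move=> form0; apply: (@common_eigenvector_reducible _ _ _ _ (const_mx 1)).
  by apply/eqP => /matrixP/(_ 0 0)/eqP; rewrite !mxE oner_eq0.
move=> j; exists 1; rewrite scale1r; elim/gen_index_split: j => [|i].
  by rewrite gen_maxE last_form_const form0 subrr mulr0 scale0r addr0.
by rewrite gen_loE !mxE subrr scale0r addr0.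
Qed.

(** For t = 2 the vector w_i is - 2 e_i, so the first block sends e_0 to - e_0; the
other blocks do not touch e_0, and phi(e_0) = t - 2 = 0.  So e_0 is a common
eigenvector. *)
Lemma t2_reducible : t = 2 -> ~ irreducible (eta1'_gen (n := m.+3) t).
Proof.
move=> t2; apply: (@common_eigenvector_reducible _ _ _ _ (delta_mx ord0 0)).
  by apply/eqP => /matrixP/(_ 0 0)/eqP; rewrite !mxE oner_eq0.
elim/gen_index_split => [|i].
  by exists 1; rewrite scale1r gen_maxE /last_form t2 subrr mul0r !mxE /=
    mulr0 subrr scale0r addr0.
rewrite gen_loE /root_vec t2 subrr scale0r sub0r !mxE -!val_eqE /= andbT.
have [i0|i0] := eqVneq (i : nat) 0%N; last first.
  by exists 1; rewrite subrr scale0r addr0 scale1r.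
have -> : lo i = ord0 by apply/val_inj.
by exists (- 1); rewrite subr0 scale1r scaleN1r scaler_nat mulr2n opprD addNKr.
Qed.

(** * Invariant subspaces in the remaining case *)

Section Invariant.
Variable U : {vspace 'cV[F]_m.+2}.
Hypothesis invU : forall j v, v \in U -> eta1'_gen (n := m.+3) t j *m v \in U.

(** The difference between v and its image under a block matrix is a multiple
of w_i, so it can be divided by the nonzero factor. *)
Lemma invariant_root i v :
  v \in U -> v (lo i) 0 != v (hi i) 0 -> root_vec i \in U.
Proof.
move=> Uv; rewrite -subr_eq0 => nz.
have := invU (lo i) Uv; rewrite gen_loE.
by rewrite (rpredDl _ Uv) rpredZeq (negbTE nz).
Qed.

Lemma invariant_last v :
  v \in U -> last_form v != 0 -> delta_mx ord_max 0 \in U.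
Proof.
move=> Uv nz; have := invU ord_max Uv; rewrite gen_maxE.
by rewrite (rpredDl _ Uv) rpredZeq (negbTE nz).
Qed.

(** The vector w_i has coordinates 2 - t and 0 at i + 1 and i + 2, hence it is
moved by the next block when t != 2, and w_{i+1} follows. *)
Lemma invariant_root_max i :
  t != 2 -> root_vec i \in U -> root_vec ord_max \in U.
Proof.
move=> t2 Ui; apply: (ord_ascend (P := fun j => root_vec j \in U) Ui) => j Uj.
apply: (invariant_root (i := hi j) Uj).
rewrite !mxE -!val_eqE /= /bump /= !add1n !eqxx (gtn_eqF (ltnSn j)).
rewrite (gtn_eqF (ltnSn j.+1)) (gtn_eqF (ltnW (ltnSn j.+1))) /=.
by rewrite !mulr0 !subr0 mulr1 subr_eq0 eq_sym.
Qed.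

(** Only the last two coordinates - t and 2 - t contribute:
(t - 2) (- t) - 2 (2 - t) = - (t - 2)^2. *)
Lemma last_form_root_max : last_form (root_vec ord_max) = - (t - 2) ^+ 2.
Proof.
rewrite /last_form big_ord_recr big1 /= => [|j _].
  rewrite !mxE -!val_eqE /= /bump /= add1n !eqxx (gtn_eqF (ltnSn m)).
  by rewrite (ltn_eqF (ltnSn m)) /=; ring.
rewrite !mxE -!val_eqE /= /bump /= add1n (ltn_eqF (ltn_ord j)).
by rewrite (ltn_eqF (leqW (ltn_ord j))) !mulr0 subrr.
Qed.

(** A nonzero vector of U either has two different consecutive coordinates, which
produces a vector w_i and then w_{d-2}, or is a multiple of the vector of ones; in
both cases U contains a vector at which phi does not vanish. *)
Lemma invariant_last_basis :
  t != 2 -> (t - 2) * m.+1%:R != 2 -> U != 0%VS -> delta_mx ord_max 0 \in U.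
Proof.
move=> t2 tm U0; pose v := vpick U.
have Uv : v \in U := memv_pick U.
have v0 : v != 0 by rewrite vpick0.
have [/existsP[i vi]|] := boolP [exists i, v (lo i) 0 != v (hi i) 0].
  apply: (invariant_last (invariant_root_max t2 (invariant_root Uv vi))).
  by rewrite last_form_root_max oppr_eq0 expf_eq0 /= subr_eq0.
rewrite negb_exists => /forallP vconst.
have vE : v = const_mx (v ord_max 0).
  apply/matrixP => j k; rewrite ord1 mxE.
  apply: (ord_descend (P := fun j => v j 0 = v ord_max 0)) => // i <-.
  by apply/eqP; have := vconst i; rewrite negbK.
apply: (invariant_last Uv).
rewrite vE last_form_const mulf_neq0 ?subr_eq0 //.
apply: contraNneq v0 => c0; rewrite vE c0.
by apply/eqP/matrixP => j k; rewrite !mxE.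
Qed.

(** Descent: e_{i+1} has different coordinates at i and i + 1, so w_i is in U, and
e_i is a combination of w_i and e_{i+1} because t != 0. *)
Lemma invariant_full : t != 0 -> delta_mx ord_max 0 \in U -> U = fullv.
Proof.
move=> t0 Umax; apply: delta_full; apply: ord_descend => // i Uhi.
have : root_vec i \in U.
  apply: (invariant_root Uhi).
  by rewrite !mxE -!val_eqE /= /bump /= add1n !eqxx ltn_eqF //= eq_sym oner_eq0.
rewrite /root_vec rpredBl; last exact: memvZ.
by rewrite [_ \in _]rpredZeq (negbTE t0).
Qed.

End Invariant.

(** The condition is stated without a division, so that it makes sense in every
characteristic; for n = m + 3 it says that t is not (2n - 2) / (n - 2) as soon as
n - 2 is invertible. *)
Lemma irreducible_gen : t != 0 ->
  irreducible (eta1'_gen (n := m.+3) t) <-> (t - 2) * m.+1%:R <> 2 /\ t <> 2.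
Proof.
move=> t0; split=> [irr|[/eqP tm /eqP t2] U invU].
  by split=> [/ones_reducible|/t2_reducible].
have [->|U0] := eqVneq U 0%VS; [by left | right].
exact: invariant_full invU t0 (invariant_last_basis invU t2 tm U0).
Qed.

End Generators.

Theorem theorem8 (R : realType) (n : nat) (t : R[i])
    (hn : (2 <= n)%N) (ht0 : t <> 0) (hn2 : n = 2%N -> t <> 2) :
  (forall eta1' : twin_group n -> 'M[R[i]]_n.-1,
     is_representation eta1' ->
     (forall i : 'I_n.-1, eta1' (twin_gen i) = eta1'_gen t i) ->
     (irreducible eta1' <->
      t <> (2 * n%:R - 2) / (n%:R - 2) /\ t <> 2)) /\
  (irreducible (eta1'_gen (n := n) t) <->
   t <> (2 * n%:R - 2) / (n%:R - 2) /\ t <> 2).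
Proof.
suff gen_irr : irreducible (eta1'_gen (n := n) t) <->
    t <> (2 * n%:R - 2) / (n%:R - 2) /\ t <> 2.
  split=> // rho rho_rep rhog.
  exact: iff_trans (irreducible_generators rho_rep rhog) gen_irr.
case: n hn hn2 => [|[|[|m]]] // _ hn2.
  split=> [_|_]; last exact: irreducible_dim1.
  (* The quotient has denominator 0, and x / 0 = 0. *)
  by rewrite subrr invr0 mulr0; split=> //; apply: hn2.
apply: iff_trans (irreducible_gen m (introN eqP ht0)) _.
have m0 : m.+1%:R != 0 :> R[i] by rewrite Num.Theory.pnatr_eq0.
have -> : m.+3%:R - 2 = m.+1%:R :> R[i] by rewrite -addn2 natrD addrK.
split=> -[tm t2]; split=> // te; apply: tm.
  by rewrite te -(addn2 m.+1) natrD; field; rewrite nat1r.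
apply: (mulIf m0); rewrite divfK // -(addn2 m.+1) natrD.
have -> : t * m.+1%:R = (t - 2) * m.+1%:R + 2 * m.+1%:R by ring.
by rewrite te; ring.
Qed.
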